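(* Let $k$ and $t$ be fixed integers with $k\ge 1$ and $0\le t\le k$, and let $n\to\infty$. Then, with $\alpha_{t,k}=\bigl(\frac{k}{k+1}\bigr)^t-1$, \[ \mathbb V X_{n,t,0}=\frac{-\alpha_{t,k}^2k^4+2(t+2)\alpha_{t,k}k^3+\bigl((2t+3)(t+1)\alpha_{t,k}+3t^2+4t\bigr)k^2+t(t+1)k}{(t+1)^2}+O\Bigl(\frac1n\Bigr), \] \begin{align*} \mathbb V X_{n,t,1}&=\frac{(6k+t+3)(t+1)k^{k+t+2}+(4k+1)(k+1)^{k+1}k^{t+2}-(4k^2-2kt+3k-t)k(k+1)^{k+t+1}}{(k+1)^{k+t+1}(t+1)}\\ &\quad-\Bigl(\frac{(t+1)k^{k+t+2}+k^{t+2}(k+1)^{k+1}-k(k-t)(k+1)^{k+t+1}}{(k+1)^{k+t+1}(t+1)}\Bigr)^2+O\Bigl(\frac1n\Bigr), \end{align*} and \[ \mathbb V X_{n,t,n}=\frac{(k+1)^{2k+2}-(2k+1)(k+1)^{k+1}k^k}{k^{2k}}+O\Bigl(\frac1n\Bigr). \]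
   Context: A $k_t$-Dyck path is a lattice path consisting of up-steps $(1,k)$ and down-steps $(1,-1)$ that starts at $(0,0)$, stays weakly above the line $y=-t$, and ends on the line $y=0$; with $n$ up-steps it has length $(k+1)n$. For $0\le r\le n$, $X_{n,t,r}$ is the random variable giving the number of down-steps between the $r$-th and $(r+1)$-th up-steps (before the first up-step if $r=0$, after the last up-step if $r=n$) in a $k_t$-Dyck path with $n$ up-steps chosen uniformly at random. $\mathbb V$ denotes variance. *)

(* Defs.v *)
From HB Require Import structures.
From mathcomp Require Export all_boot all_order all_algebra.
From mathcomp Require Export functions reals topology normedtype landau.
Set Implicit Arguments.
Unset Strict Implicit.
Unset Printing Implicit Defensive.
Import Order.TTheory GRing.Theory Num.Theory.
Local Open Scope ring_scope.

(* A lattice path starting at (0,0) is the sequence of its steps: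
   [true] is an up-step (1,k), [false] is a down-step (1,-1). *)
Definition height (k : nat) (s : seq bool) : int :=
  \sum_(b <- s) (if b then k%:Z else -1).

Definition kt_dyck (k t : nat) (s : seq bool) : bool :=
  all (fun i => - t%:Z <= height k (take i s)) (iota 0 (size s).+1)
  && (height k s == 0).

Definition kt_dyck_paths (k t n : nat) : {set (k.+1 * n).-tuple bool} :=
  [set s : (k.+1 * n).-tuple bool | kt_dyck k t s & count id s == n].

(* The down-steps between the r-th and the (r+1)-th up-steps are exactly those
   preceded by r up-steps; this covers r = 0 and r = number of up-steps. *)
Definition down_steps (r : nat) (s : seq bool) : nat :=
  count (fun i => ~~ nth true s i && (count id (take i s) == r))
    (iota 0 (size s)).

(* Mean and variance with respect to the uniform distribution on A. *)
Definition unif_mean (R : realType) (T : finType) (A : {set T}) (X : T -> R) : R :=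
  (\sum_(x in A) X x) / #|A|%:R.

Definition unif_var (R : realType) (T : finType) (A : {set T}) (X : T -> R) : R :=
  unif_mean A (fun x => (X x - unif_mean A X) ^+ 2).

Definition varX (R : realType) (k n t r : nat) : R :=
  unif_var (kt_dyck_paths k t n)
    (fun s : (k.+1 * n).-tuple bool => (down_steps r s)%:R : R).

Definition alpha (R : realType) (t k : nat) : R := (k%:R / (k%:R + 1)) ^+ t - 1.

(* Main.v *)
(** Appending [t + 1] down-steps turns a k_t-Dyck path with [n >= 1] up-steps into
    a path from height [t] that first reaches [-1] at its end, and conversely,
    because after its last up-step such a path is at height at least [k >= t].
    These are counted by the Raney numbers, the coefficients of [B ^ (t + 1)]
    where [B = 1 + x B ^ (k + 1)].  Removing the first one or two runs leaves
    paths of the same kind, so the laws of the first two runs are quotients of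
    Raney numbers, which converge at rate [1/n]; their limits are truncated
    geometric laws tilted by a linear factor, with closed-form moments.  For the
    last run, of length [L = X + t + 1] after the completion, inserting one or two
    new up-steps into it gives [sum L = C_(n+1)] and
    [sum (L (L - 1) / 2 + (k + 1) L) = C_(n+2)], where [C_n] is the number of
    paths, so its variance is a polynomial in [C_(n+1) / C_n] and
    [C_(n+2) / C_n]. *)

Require Import Defs.
From mathcomp Require Import zify ring lra.
Import Order.TTheory GRing.Theory Num.Theory.
Import numFieldNormedType.Exports.
Local Open Scope ring_scope.
Local Open Scope classical_set_scope.
Set Implicit Arguments.
Unset Strict Implicit.
Unset Printing Implicit Defensive.

(** * Raney numbers: closed form and exact ratios *)

(* The number of paths with [n] up-steps from height [a] that reach height [0]
   only at their end, in terms of the first step. *)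
Fixpoint raney (k n a : nat) : nat :=
  if n is n'.+1 then
    (fix raneyS a := if a is a'.+1 then raneyS a' + raney k n' (a'.+1 + k) else 0)%N a
  else 1%N.

Lemma raneySS k n a :
  raney k n.+1 a.+1 = (raney k n.+1 a + raney k n (a.+1 + k))%N.
Proof. by []. Qed.

Lemma raneyS1 k n : raney k n.+1 1 = raney k n k.+1.
Proof. by []. Qed.

Lemma raney1 k a : raney k 1 a = a.
Proof. by elim: a => // a IH; rewrite raneySS IH /= addn1. Qed.

Lemma raney_gt0 k n a : (0 < raney k n a.+1)%N.
Proof.
elim: n a => // n IH; elim=> [|a IHa]; first by rewrite raneyS1.
by rewrite raneySS addn_gt0 IHa.
Qed.

(** Raney's formula [a / N * binomial(N, n + 1)] with [N = (k + 1) * (n + 1) + a], cleared of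
    divisions. *)
Lemma raney_ffact k n a :
  (raney k n.+1 a * n.+1`! = a * ((k.+1 * n.+1 + a).-1 ^_ n))%N.
Proof.
elim: n a => [|n IH] a; first by rewrite raney1 ffactn0.
elim: a => // a IHa; rewrite raneySS mulnDl IHa factS (mulnCA (raney _ _ _)) IH.
set M := (k.+1 * n.+2 + a).-1.
have -> : (k.+1 * n.+2 + a.+1).-1 = M.+1 by rewrite /M; lia.
have -> : (k.+1 * n.+1 + (a.+1 + k)).-1 = M by rewrite /M; lia.
rewrite ffactSS ffactnSr.
have : (n <= M)%N by rewrite /M; nia.
set P := (M ^_ n)%N => leM.
have -> : M.+1 = (k.+1 * n.+2 + a)%N by rewrite /M; lia.
have : (M - n = k.+1 * n.+2 + a - n.+1)%N by rewrite /M; lia.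
move=> ->.
have : (k.+1 * n.+2 + a - n.+1 = k * n.+2 + a + 1)%N by lia.
by move=> ->; lia.
Qed.

(** The two closed forms are compared through [M * M.-1 ^_ n = M ^_ n * (M - n)]. *)
Lemma raney_ratio k n a : (0 < n)%N ->
  (a * (k * n + a.+1) * raney k n a.+1 = a.+1 * (k.+1 * n + a) * raney k n a)%N.
Proof.
case: n => // n _.
apply/eqP; rewrite -(eqn_pmul2r (fact_gt0 n.+1)) -!mulnA !raney_ffact.
have -> : (k.+1 * n.+1 + a.+1).-1 = (k.+1 * n.+1 + a)%N by lia.
set M := (k.+1 * n.+1 + a)%N.
have M0 : M = M.-1.+1 by rewrite /M; lia.
have : (M * M.-1 ^_ n = M ^_ n * (M - n))%N by rewrite -ffactnSr {3}M0 ffactSS -M0.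
have -> : (M - n = k * n.+1 + a.+1)%N by rewrite /M; lia.
by set P := (M ^_ n)%N; set Q := (M.-1 ^_ n)%N => H; apply/eqP; nia.
Qed.

Lemma raney2 k a : (2 * raney k 2 a = a * (2 * k.+1 + a).-1)%N.
Proof. by have := raney_ffact k 1 a; rewrite ffactn1 mulnC (mulnC 2 k.+1). Qed.

(** * Runs of down-steps under removal of the first step or run *)

Lemma down_steps_true r s :
  down_steps r (true :: s) = if r is r'.+1 then down_steps r' s else 0%N.
Proof.
rewrite /down_steps /= (iotaDl 1 0) count_map add0n.
case: r => [|r]; last by [].
by rewrite (eq_count (a2 := pred0)) ?count_pred0 // => i /=; rewrite andbF.
Qed.

Lemma down_steps_false r s :
  down_steps r (false :: s) = ((r == 0) + down_steps r s)%N.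
Proof. by rewrite /down_steps /= (iotaDl 1 0) count_map eq_sym. Qed.

Lemma down_steps_run r i s :
  down_steps r (nseq i false ++ true :: s) =
  if r is r'.+1 then down_steps r' s else i.
Proof.
elim: i => [|i IH] /=; first by rewrite down_steps_true; case: r.
by rewrite down_steps_false IH; case: r {IH}.
Qed.

(** * Sums over paths and their first-step recursion *)

Section PathSums.
Variables (R : comNzRingType) (k t : nat).
Implicit Type F : seq bool -> R.

(* The sum of [F] over the paths of length [m] that start at height [h],
   stay weakly above [0], and end at height [t]. *)
Fixpoint path_sum (m h : nat) F : R :=
  if m is m'.+1 then
    path_sum m' (h + k) (fun s => F (true :: s)) +
    (if h is h'.+1 then path_sum m' h' (fun s => F (false :: s)) else 0)
  else if h == t then F [::] else 0.

Lemma eq_path_sum m h F G : F =1 G -> path_sum m h F = path_sum m h G.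
Proof.
elim: m h F G => [|m IH] h F G FG /=; first by rewrite FG.
congr (_ + _); first by apply: IH => s; rewrite FG.
by case: h => // h; apply: IH => s; rewrite FG.
Qed.

Lemma path_sum0 m h F : (t + m < h)%N -> path_sum m h F = 0.
Proof.
elim: m h F => [|m IH] h F /= lt_h; first by case: eqP => // E; lia.
rewrite IH ?add0r; last by lia.
by case: h lt_h => // h lt_h; rewrite IH //; lia.
Qed.

(** Translation by [t] moves the barrier to [0], and the free starting height makes the notion
    stable under removal of the first step. *)
Definition in_strip (h : nat) (s : seq bool) : bool :=
  all (fun i => 0 <= h%:Z + height k (take i s)) (iota 0 (size s).+1)
  && (h%:Z + height k s == t%:Z).

Lemma height_cons b s : height k (b :: s) = (if b then k%:Z else -1) + height k s.
Proof. by rewrite /height big_cons. Qed.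

Lemma in_strip_cons h b s : in_strip h (b :: s) =
  if b then in_strip (h + k) s else if h is h'.+1 then in_strip h' s else false.
Proof.
rewrite /in_strip.
have -> : iota 0 (size (b :: s)).+1 = 0%N :: [seq i.+1 | i <- iota 0 (size s).+1].
  by rewrite -[_.+1]/(1 + _.+1)%N iotaD [X in X ++ _]/= [iota (0 + 1) _](iotaDl 1 0).
set I := iota 0 (size s).+1.
rewrite -[0%N :: _]cat1s all_cat all_seq1 take0 all_map.
rewrite [height k [::]]big_nil addr0 le0z_nat andTb.
have E x : h%:Z + ((if b then k%:Z else -1) + x) =
    (if b then (h + k)%N%:Z else h%:Z - 1) + x by case: (b); lia.
rewrite [height k (b :: s)]height_cons E.
under eq_all => i do rewrite /= height_cons E.
(* A down-step from height [0] fails at the empty prefix of the rest, already at height [-1]. *)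
case: b {E} => //; case: h => [|h]; first by rewrite /I /= take0 [height _ [::]]big_nil.
by have -> : h.+1%:Z - 1 = h by lia.
Qed.

Lemma sum_tupleS m (P : pred (seq bool)) F :
  \sum_(s : m.+1.-tuple bool | P s) F s =
  \sum_(s : m.-tuple bool | P (true :: s)) F (true :: s) +
  \sum_(s : m.-tuple bool | P (false :: s)) F (false :: s).
Proof.
rewrite (reindex (fun p : bool * m.-tuple bool => cons_tuple p.1 p.2)) /=; last first.
  exists (fun s => (thead s, behead_tuple s)) => [[b s]|s] _ /=.
    by congr (_, _); apply: val_inj.
  by rewrite [RHS]tuple_eta; apply: val_inj.
rewrite -(pair_big_dep xpredT (fun b (s : m.-tuple bool) => P (b :: s))
  (fun b (s : m.-tuple bool) => F (b :: s))) /=.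
by rewrite big_bool.
Qed.

Lemma path_sumE m h F :
  \sum_(s : m.-tuple bool | in_strip h s) F s = path_sum m h F.
Proof.
elim: m h F => [|m IH] h F /=.
  rewrite (eq_bigl (fun s : 0.-tuple bool => h == t)); last first.
    move=> s; rewrite tuple0 /in_strip /= /height !big_nil !addr0 le0z_nat /=.
    by rewrite eqz_nat.
  case: eqP => E; last by rewrite big_pred0.
  rewrite (big_pred1 [tuple]) // => s.
  by apply/esym/eqP/tuple0.
rewrite sum_tupleS -!IH; congr (_ + _).
  by apply: eq_bigl => s; rewrite in_strip_cons.
case: h => [|h]; last first.
  by rewrite -IH; apply: eq_bigl => s; rewrite in_strip_cons.
by rewrite big_pred0 // => s; rewrite in_strip_cons.
Qed.

Lemma heightE s : height k s = k%:Z * (count id s)%:Z - (size s)%:Z + (count id s)%:Z.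
Proof.
elim: s => [|b s IH]; first by rewrite [height _ _]big_nil /=; lia.
by rewrite height_cons IH; case: b => /=; lia.
Qed.

(** The length [k.+1 * n] and the final height [0] together force exactly [n] up-steps. *)
Lemma mem_kt_dyck_paths n (s : (k.+1 * n).-tuple bool) :
  (s \in kt_dyck_paths k t n) = in_strip t s.
Proof.
rewrite inE /kt_dyck /in_strip -andbA; congr (_ && _).
  by apply: eq_all => i; rewrite -subr_ge0 opprK addrC.
rewrite -{2}[t%:Z]addr0 (inj_eq (addrI _)) heightE size_tuple.
apply/andP/idP => [[]//|E]; split => //; apply/eqP; move/eqP: E; nia.
Qed.

(* A path from [h] to [t] with [n] up-steps has length [h + k.+1 * n - t]; the
   subtraction is truncated, so this is meaningful only for [t <= h + k.+1 * n]. *)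
Definition ups_sum (n h : nat) F : R := path_sum (h + k.+1 * n - t) h F.

Lemma sum_kt_dyck n F :
  \sum_(s in kt_dyck_paths k t n) F s = ups_sum n t F.
Proof.
rewrite /ups_sum addKn -path_sumE.
by apply: eq_bigl => s; rewrite mem_kt_dyck_paths.
Qed.

Lemma eq_ups_sum n h F G : F =1 G -> ups_sum n h F = ups_sum n h G.
Proof. exact: eq_path_sum. Qed.

Hypothesis ht : (t <= k)%N.

Lemma ups_sum0 h F : (t <= h)%N -> ups_sum 0 h F = F (nseq (h - t) false).
Proof.
rewrite /ups_sum muln0 addn0 => le_th.
rewrite -{2}(subnK le_th); elim: (h - t)%N F => [|m IH] F /=.
  by rewrite add0n eqxx.
(* After an up-step, too few steps would remain to descend to [t]. *)
by rewrite IH path_sum0 ?add0r //; lia.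
Qed.

Lemma ups_sumS0 n F : ups_sum n.+1 0 F = ups_sum n k (fun s => F (true :: s)).
Proof.
rewrite /ups_sum; have -> : (0 + k.+1 * n.+1 - t)%N = (k + k.+1 * n - t).+1 by lia.
by rewrite /= addr0.
Qed.

Lemma ups_sumSS n h F : ups_sum n.+1 h.+1 F =
  ups_sum n (h.+1 + k) (fun s => F (true :: s)) +
  ups_sum n.+1 h (fun s => F (false :: s)).
Proof.
rewrite /ups_sum.
have -> : (h.+1 + k.+1 * n.+1 - t)%N = (h + k.+1 * n.+1 - t).+1 by lia.
by have -> : (h.+1 + k + k.+1 * n - t)%N = (h + k.+1 * n.+1 - t)%N by lia.
Qed.

Lemma ups_sumS n h F : ups_sum n.+1 h F =
  \sum_(i < h.+1) ups_sum n (h - i + k) (fun s => F (nseq i false ++ true :: s)).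
Proof.
elim: h F => [|h IH] F; first by rewrite big_ord1 ups_sumS0.
by rewrite ups_sumSS IH [RHS]big_ord_recl.
Qed.

(** Steps up to the last up-step do not affect the last run, so the first-step recursion determines
    these sums from the paths without up-steps, each a single run of length [h - t]. The side
    condition excludes starting below [t] with no up-step left; it persists because an up-step leads
    to height at least [k >= t]. *)
Lemma ups_sum_rec (Phi : nat -> nat -> R) (f : nat -> R) :
  (forall n, Phi n.+1 0 = Phi n k) ->
  (forall n h, Phi n.+1 h.+1 = Phi n (h.+1 + k)%N + Phi n.+1 h) ->
  (forall h, (t <= h)%N -> Phi 0 h = f (h - t)%N) ->
  forall n h, (0 < n)%N || (t <= h)%N ->
  ups_sum n h (fun s => f (down_steps n s)) = Phi n h.
Proof.
move=> PhiS0 PhiSS Phi0; elim=> [|n IH] h /=.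
  move=> le_th; rewrite ups_sum0 // Phi0 //; congr f.
  by elim: (h - t)%N => // m IHm /=; rewrite down_steps_false IHm.
move=> _; elim: h => [|h IHh].
  rewrite ups_sumS0 PhiS0 -IH; last by rewrite ht orbT.
  by apply: eq_ups_sum => s; rewrite down_steps_true.
rewrite ups_sumSS PhiSS -IHh -IH; last by rewrite (leq_trans ht) ?orbT ?leq_addl.
congr (_ + _); apply: eq_ups_sum => s; first by rewrite down_steps_true.
by rewrite down_steps_false.
Qed.

(** The index is [h.+1] because the completed path ends one unit below the barrier. *)
Lemma ups_sum_cst n h c : (0 < n)%N || (t <= h)%N ->
  ups_sum n h (fun=> c) = c * (raney k n h.+1)%:R.
Proof.
move=> nh; apply: (ups_sum_rec (f := fun=> c)
  (Phi := fun n h => c * (raney k n h.+1)%:R)) nh => //.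
- by move=> {}n {}h; rewrite raneySS natrD mulrDr addrC.
- by move=> {}h _; rewrite mulr1.
Qed.

Lemma ups_sum_first n f :
  ups_sum n.+1 t (fun s => f (down_steps 0 s)) =
  \sum_(i < t.+1) f i * (raney k n (t - i + k).+1)%:R.
Proof.
rewrite ups_sumS; apply: eq_bigr => i _.
rewrite -ups_sum_cst; last by rewrite (leq_trans ht) ?orbT ?leq_addl.
by apply: eq_ups_sum => s; rewrite down_steps_run.
Qed.

Lemma ups_sum_second n f :
  ups_sum n.+2 t (fun s => f (down_steps 1 s)) =
  \sum_(i < t.+1) \sum_(j < (t - i + k).+1)
    f j * (raney k n (t - i + k - j + k).+1)%:R.
Proof.
rewrite ups_sumS; apply: eq_bigr => i _; rewrite ups_sumS; apply: eq_bigr => j _.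
rewrite -ups_sum_cst; last by rewrite (leq_trans ht) ?orbT ?leq_addl.
by apply: eq_ups_sum => s; rewrite !down_steps_run.
Qed.

(** Cut after up-step [n.+1], a path with [n.+2] up-steps is one with [n.+1] up-steps whose
    completed last run, of length [L], is replaced by one of [raney k 1 L = L] continuations. *)
Lemma ups_sum_last1 n :
  ups_sum n.+1 t (fun s => ((down_steps n.+1 s)%:R + t.+1%:R)) =
  (raney k n.+2 t.+1)%:R.
Proof.
apply: (ups_sum_rec (f := fun d => d%:R + t.+1%:R)
  (Phi := fun n h => (raney k n.+1 h.+1)%:R)) => //.
- by move=> {}n {}h; rewrite raneySS natrD addrC.
- by move=> h le_th; rewrite raney1 -natrD; congr _%:R; lia.
Qed.

(** Now the continuation has two up-steps, and [raney k 2 L] is [L * (L + 2 * k + 1) / 2]. *)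
Lemma ups_sum_last2 n :
  ups_sum n.+1 t (fun s => ((down_steps n.+1 s)%:R + t.+1%:R) *
    ((down_steps n.+1 s)%:R + t.+1%:R + (2 * k + 1)%:R)) =
  2 * (raney k n.+3 t.+1)%:R.
Proof.
apply: (ups_sum_rec (f := fun d => (d%:R + t.+1%:R) * (d%:R + t.+1%:R + (2 * k + 1)%:R))
  (Phi := fun n h => 2 * (raney k n.+2 h.+1)%:R)) => //.
- by move=> {}n {}h; rewrite raneySS natrD mulrDr addrC.
- move=> h le_th; rewrite -!natrD -!natrM; congr _%:R; rewrite raney2.
  by congr (_ * _)%N; lia.
Qed.

End PathSums.

(** * Calculus of convergence at rate [1/n] *)

Section Rate.
Variable R : realFieldType.
Implicit Types (f g : nat -> R) (c d : R).

Definition rate_to f c :=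
  exists C, exists N, forall n, (N < n)%N -> `|f n - c| <= C / n%:R.

(** The threshold [1 < n] suits the second run, whose formula requires two up-steps. *)
Lemma rate_to_eq f g c :
  (forall n, (1 < n)%N -> f n = g n) -> rate_to f c -> rate_to g c.
Proof.
move=> fg [C [N fC]]; exists C, N.+1 => n lt_n.
by rewrite -fg ?fC //; lia.
Qed.

Lemma rate_to_cst c : rate_to (fun=> c) c.
Proof. by exists 0, 0%N => n _; rewrite subrr normr0 mul0r. Qed.

Lemma rate_toD f g c d :
  rate_to f c -> rate_to g d -> rate_to (fun n => f n + g n) (c + d).
Proof.
move=> [C [N fC]] [D [M gD]]; exists (C + D), (maxn N M) => n.
rewrite gtn_max => /andP[/fC fn /gD gn].
by rewrite opprD addrACA mulrDl (le_trans (ler_normD _ _)) // lerD.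
Qed.

Lemma rate_toM f g c d :
  rate_to f c -> rate_to g d -> rate_to (fun n => f n * g n) (c * d).
Proof.
move=> [C [N fC]] [D [M gD]]; exists (C * D + C * `|d| + `|c| * D), (maxn N M) => n.
rewrite gtn_max => /andP[lt_N lt_M].
have {fC} fn := fC _ lt_N; have {gD} gn := gD _ lt_M.
have n1 : 1 <= n%:R :> R by rewrite ler1n; lia.
have n0 : 0 < n%:R :> R by lra.
have C0 : 0 <= C by rewrite -(pmulr_lge0 _ (x := n%:R^-1)) ?invr_gt0 ?(le_trans _ fn).
have D0 : 0 <= D by rewrite -(pmulr_lge0 _ (x := n%:R^-1)) ?invr_gt0 ?(le_trans _ gn).
have -> : f n * g n - c * d = (f n - c) * (g n - d) + (f n - c) * d + c * (g n - d).
  by ring.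
rewrite [leRHS]mulrDl; apply: le_trans (ler_normD _ _) _; apply: lerD; last first.
  by rewrite normrM -mulrA ler_wpM2l.
rewrite [leRHS]mulrDl; apply: le_trans (ler_normD _ _) _.
apply: lerD; rewrite normrM; last first.
  by rewrite mulrAC ler_wpM2r.
(* The product of the two errors is of order [1/n^2], absorbed into [1/n] since [n >= 1]. *)
apply: le_trans (ler_pM _ _ fn gn) _ => //.
rewrite mulrACA ler_wpM2l ?mulr_ge0 // ler_piMl ?invr_ge0 ?(ltW n0) //.
by rewrite invf_le1.
Qed.

Lemma rate_to_sum (I : finType) (f : I -> nat -> R) (c : I -> R) :
  (forall i, rate_to (f i) (c i)) ->
  rate_to (fun n => \sum_i f i n) (\sum_i c i).
Proof.
move=> fc; rewrite unlock /=.
elim: (index_enum I) => [|i s IH] /=; first exact: rate_to_cst.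
exact: rate_toD.
Qed.

Lemma rate_to_succ f c : rate_to f c -> rate_to (fun n => f n.+1) c.
Proof.
move=> [C [N fC]]; exists C, N.+1 => n lt_n.
have fn := fC n.+1 (ltnW (leqW lt_n)).
have n0 : 0 < n%:R :> R by rewrite ltr0n; lia.
have C0 : 0 <= C.
  by rewrite -(pmulr_lge0 _ (x := n.+1%:R^-1)) ?invr_gt0 ?ltr0n ?(le_trans _ fn).
by rewrite (le_trans fn) // ler_wpM2l // lef_pV2 ?posrE ?ltr0n ?ler_nat //; lia.
Qed.

Lemma rate_to_pred f c : rate_to f c -> rate_to (fun n => f n.-1) c.
Proof.
(* The factor [2] comes from [1 / n.+1 <= 2 / n.+2]. *)
move=> [C [N fC]]; exists (2 * C), N.+2 => -[//|[//|n]] lt_n /=.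
have fn := fC n.+1 ltac:(lia).
have C0 : 0 <= C.
  by rewrite -(pmulr_lge0 _ (x := n.+1%:R^-1)) ?invr_gt0 ?ltr0n ?(le_trans _ fn).
rewrite (le_trans fn) // mulrAC mulrC ler_wpM2r //.
rewrite -[n.+1%:R^-1]div1r ler_pdivrMr ?ltr0n // mulrAC ler_pdivlMr ?ltr0n //.
by rewrite mul1r -natrM ler_nat; lia.
Qed.

Lemma rate_to_affine (p r p' r' : R) : 0 < p' -> 0 <= r' ->
  rate_to (fun n => (p * n%:R + r) / (p' * n%:R + r')) (p / p').
Proof.
move=> p'0 r'0; exists (`|r * p' - p * r'| / (p' * p')), 0%N => n n0.
have {}n0 : 0 < n%:R :> R by rewrite ltr0n.
have pn0 : 0 < p' * n%:R by rewrite mulr_gt0.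
have d0 : 0 < p' * n%:R + r' by rewrite ltr_wpDr.
have -> : (p * n%:R + r) / (p' * n%:R + r') - p / p' =
  (r * p' - p * r') / (p' * (p' * n%:R + r')).
  by field; rewrite !gt_eqF.
rewrite normrM -mulrA ler_wpM2l // -invfM ger0_norm; last first.
  by rewrite invr_ge0 ltW // mulr_gt0.
by rewrite lef_pV2 ?posrE ?mulr_gt0 // -mulrA ler_pM2l // lerDl.
Qed.

End Rate.

(** * Limits of quotients of Raney numbers *)

Lemma telescope_div (F : fieldType) (x y z : F) : y != 0 -> x / y * (y / z) = x / z.
Proof. by move=> y0; rewrite mulrA mulfVK. Qed.

Section Ratios.
Variables (R : realFieldType) (k : nat).
Hypothesis hk : (0 < k)%N.
Local Notation K := (k%:R : R).
Local Notation F n a := ((raney k n a)%:R : R).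

(* [raney k n a] is asymptotically proportional to [weight a], the coefficients
   of [B ^ a] being governed by the value [(k + 1) / k] of [B] at its singularity. *)
Definition weight (a : nat) : R := a%:R * ((K + 1) / K) ^+ a.

Let K0 : 0 < K. Proof. by rewrite ltr0n. Qed.
Let K1 : 0 < K + 1. Proof. by rewrite addr_gt0. Qed.

Lemma weight_gt0 a : 0 < weight a.+1.
Proof. by rewrite mulr_gt0 ?ltr0n // exprn_gt0 // divr_gt0. Qed.

Lemma raney_neq0 n a : F n a.+1 != 0.
Proof. by rewrite pnatr_eq0 -lt0n raney_gt0. Qed.

Lemma raney_ratioE n a : (0 < n)%N ->
  F n a.+2 = F n a.+1 * (a.+2%:R / a.+1%:R) *
    (((K + 1) * n%:R + a.+1%:R) / (K * n%:R + a.+2%:R)).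
Proof.
move=> n0; have /(congr1 (fun m : nat => m%:R : R)) := raney_ratio k a.+1 n0.
rewrite !natrM !natrD !natrM => H.
have d0 : K * n%:R + a.+2%:R != 0 by rewrite gt_eqF // ltr_wpDl ?mulr_ge0 ?ltr0n.
have a0 : a.+1%:R != 0 :> R by rewrite pnatr_eq0.
move: d0 a0 H; move: (a.+1%:R) (a.+2%:R) => x y d0 x0 H.
apply: (mulfI (mulf_neq0 x0 d0)); rewrite H; field.
by rewrite d0 x0.
Qed.

(** By the exact ratio, this quotient is a constant times a quotient of affine functions of [n]. *)
Lemma rate_to_raney_up a :
  rate_to (fun n => F n a.+2 / F n a.+1) (weight a.+2 / weight a.+1).
Proof.
have -> : weight a.+2 / weight a.+1 = (a.+2%:R / a.+1%:R) * ((K + 1) / K).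
  rewrite /weight [_ ^+ a.+2]exprS -mulf_div mulfK //.
  by rewrite expf_neq0 // gt_eqF // divr_gt0.
apply: rate_to_eq (rate_toM (rate_to_cst _)
  (rate_to_affine (K + 1) a.+1%:R K0 (ler0n _ a.+2))).
move=> n n1 /=; rewrite (raney_ratioE _ (ltnW n1)) -[F n _ * _ * _]mulrA.
by rewrite [RHS]mulrAC mulfV ?mul1r ?raney_neq0.
Qed.

Lemma rate_to_raney_down a :
  rate_to (fun n => F n a.+1 / F n a.+2) (weight a.+1 / weight a.+2).
Proof.
have -> : weight a.+1 / weight a.+2 = (a.+1%:R / a.+2%:R) * (K / (K + 1)).
  rewrite /weight [_ ^+ a.+2]exprSr -mulf_div; congr (_ * _).
  rewrite invfM mulrA mulfV ?mul1r ?invf_div //.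
  by rewrite expf_neq0 // gt_eqF // divr_gt0.
apply: rate_to_eq (rate_toM (rate_to_cst _)
  (rate_to_affine K a.+2%:R K1 (ler0n _ a.+1))).
move=> n n1 /=; rewrite (raney_ratioE _ (ltnW n1)) -[F n _ * _ * _]mulrA.
by rewrite [in RHS]invfM [RHS]mulrA mulfV ?raney_neq0 // mul1r invfM !invf_div.
Qed.

(** Neighbouring quotients telescope down to [raney k n 1], the common reference for all indices. *)
Lemma rate_to_raney_base b :
  rate_to (fun n => F n b / F n 1) (weight b / weight 1).
Proof.
case: b => [|b].
  rewrite /weight !mul0r; apply: rate_to_eq (rate_to_cst 0).
  by case=> // n _; rewrite mul0r.
elim: b => [|b IH].
  rewrite divff ?gt_eqF ?weight_gt0 //; apply: rate_to_eq (rate_to_cst 1).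
  by move=> n _; rewrite divff ?raney_neq0.
have /= := rate_toM (rate_to_raney_up b) IH.
rewrite telescope_div ?gt_eqF ?weight_gt0 //; apply: rate_to_eq => n _.
by rewrite telescope_div ?raney_neq0.
Qed.

Lemma rate_to_raney_base_inv a :
  rate_to (fun n => F n 1 / F n a.+1) (weight 1 / weight a.+1).
Proof.
elim: a => [|a IH].
  rewrite divff ?gt_eqF ?weight_gt0 //; apply: rate_to_eq (rate_to_cst 1).
  by move=> n _; rewrite divff ?raney_neq0.
have /= := rate_toM IH (rate_to_raney_down a).
rewrite telescope_div ?gt_eqF ?weight_gt0 //; apply: rate_to_eq => n _.
by rewrite telescope_div ?raney_neq0.
Qed.

Lemma rate_to_raney b a :
  rate_to (fun n => F n b / F n a.+1) (weight b / weight a.+1).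
Proof.
have /= := rate_toM (rate_to_raney_base b) (rate_to_raney_base_inv a).
rewrite telescope_div ?gt_eqF ?weight_gt0 //; apply: rate_to_eq => n _.
by rewrite telescope_div ?raney_neq0.
Qed.

(** The exponential growth rate [(k + 1)^(k + 1) / k^k] of the Raney numbers in [n]. *)
Definition growth : R := weight k.+1 / weight 1.

Lemma growthE : growth = (K + 1) * ((K + 1) / K) ^+ k.
Proof.
rewrite /growth /weight expr1 mul1r exprSr mulrA mulfK ?natr1 //.
by rewrite gt_eqF // divr_gt0.
Qed.

(* The shift in [n] rests on the exact relation [raneyS1]. *)
Lemma rate_to_raney_succ b a :
  rate_to (fun n => F n.+1 b / F n a.+1) (weight b / weight a.+1 * growth).
Proof.
have := rate_toM (rate_to_succ (rate_to_raney b 0)) (rate_to_raney k.+1 a).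
have -> : weight b / weight 1 * (weight k.+1 / weight a.+1) =
          weight b / weight a.+1 * growth.
  by rewrite mulf_div [weight 1 * _]mulrC -mulf_div.
apply: rate_to_eq => n _; rewrite -raneyS1 telescope_div //.
by rewrite raneyS1 raney_neq0.
Qed.

Lemma rate_to_raney_pred b a :
  rate_to (fun n => F n.-1 b / F n a.+1) (weight b / weight a.+1 / growth).
Proof.
have := rate_toM (rate_to_pred (rate_to_raney b k)) (rate_to_raney 1 a).
have -> : weight b / weight k.+1 * (weight 1 / weight a.+1) =
          weight b / weight a.+1 / growth.
  by rewrite /growth invf_div mulf_div [weight k.+1 * _]mulrC -mulf_div.
apply: rate_to_eq => -[//|n] _; rewrite -[n.+1.-1]/n -raneyS1 telescope_div //.
by rewrite raneyS1 raney_neq0.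
Qed.

Lemma rate_to_raney_succ2 b a :
  rate_to (fun n => F n.+2 b / F n a.+1) (weight b / weight a.+1 * growth ^+ 2).
Proof.
have := rate_toM (rate_to_succ (rate_to_raney_succ b 0)) (rate_to_raney_succ 1 a).
rewrite mulrACA -expr2 telescope_div ?gt_eqF ?weight_gt0 //.
by apply: rate_to_eq => n _; rewrite telescope_div ?raney_neq0.
Qed.

Lemma rate_to_raney_pred2 b a :
  rate_to (fun n => F n.-2 b / F n a.+1) (weight b / weight a.+1 / growth ^+ 2).
Proof.
have := rate_toM (rate_to_pred (rate_to_raney_pred b 0)) (rate_to_raney_pred 1 a).
rewrite mulrACA -expr2 exprVn telescope_div ?gt_eqF ?weight_gt0 //.
by apply: rate_to_eq => n _; rewrite telescope_div ?raney_neq0.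
Qed.

(** The hypothesis is the height balance after [m] up-steps and [i] down-steps. The powers then
    cancel down to the geometric law in [i], tilted by the linear factor [b]. *)
Lemma weight_shift m a b i : (b + i = a.+1 + m * k)%N ->
  weight b / weight a.+1 / growth ^+ m =
  b%:R / (a.+1%:R * (K + 1) ^+ m) * (K / (K + 1)) ^+ i.
Proof.
move=> E; rewrite growthE exprMn -exprM /weight.
set x := (K + 1) / K.
have x0 : x != 0 by rewrite mulf_neq0 ?invr_eq0 ?gt_eqF.
have -> : K / (K + 1) = x^-1 by rewrite invf_div.
have a0 : a.+1%:R != 0 :> R by rewrite pnatr_eq0.
have : x ^+ b * x ^+ i = x ^+ a.+1 * x ^+ (k * m) by rewrite -!exprD E mulnC.
have xb : x ^+ b != 0 by rewrite expf_neq0.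
have xi : x ^+ i != 0 by rewrite expf_neq0.
have xa : x ^+ a.+1 != 0 by rewrite expf_neq0.
have xm : x ^+ (k * m) != 0 by rewrite expf_neq0.
have Km : (K + 1) ^+ m != 0 by rewrite expf_neq0 // gt_eqF.
rewrite exprVn; move: xb xi xa xm Km a0.
move: (x ^+ b) (x ^+ i) (x ^+ a.+1) (x ^+ (k * m)) ((K + 1) ^+ m) (a.+1%:R : R).
move=> B I A M P y B0 I0 A0 M0 P0 y0 E1.
rewrite -[B](mulfK I0) E1; field.
by rewrite ?I0 ?A0 ?M0 ?P0 ?y0.
Qed.

Lemma weight_self a : weight a.+1 / weight a.+1 = 1.
Proof. by rewrite divff // gt_eqF // weight_gt0. Qed.

End Ratios.

(** * Closed forms for polynomial and geometric sums *)

Section ClosedSums.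
Variables (R : realFieldType).

(* [K + 1] times the operator [1 + K D + K^2 D^2 + K^3 D^3], [D] the forward
   difference; it inverts [p x |-> p x - q p (x + 1)], [q = K / (K + 1)], on cubics. *)
Definition geom_antidiff (K : R) (f : R -> R) (x : R) : R :=
  (K + 1) * (f x + K * (f (x + 1) - f x) + K ^+ 2 * (f (x + 2) - 2 * f (x + 1) + f x)
    + K ^+ 3 * (f (x + 3) - 3 * f (x + 2) + 3 * f (x + 1) - f x)).

(** The hypothesis makes fourth differences vanish, so the truncated series in [geom_antidiff] is an
    exact inverse and the sum telescopes. *)
Lemma sum_cubic_geom (K : R) (f : R -> R) N : K + 1 != 0 ->
  (forall x, f (x + 4) = 4 * f (x + 3) - 6 * f (x + 2) + 4 * f (x + 1) - f x) ->
  \sum_(j < N) f j%:R * (K / (K + 1)) ^+ j =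
  geom_antidiff K f 0 - geom_antidiff K f N%:R * (K / (K + 1)) ^+ N.
Proof.
move=> K1 f4; elim: N => [|N IH]; first by rewrite big_ord0 expr0 mulr1 subrr.
rewrite big_ord_recr /= IH exprS /geom_antidiff -[N.+1%:R]natr1.
have -> : N%:R + 1 + 1 = N%:R + 2 :> R by ring.
have -> : N%:R + 1 + 2 = N%:R + 3 :> R by ring.
have -> : N%:R + 1 + 3 = N%:R + 4 :> R by ring.
rewrite f4; move: (f N%:R) (f _) (f _) (f _) ((K / (K + 1)) ^+ N) => a b c d e.
by field.
Qed.

(** Newton's summation formula for vanishing third differences; the induction splits off the first
    term and shifts [f]. *)
Lemma sum_quadratic (f : R -> R) N :
  (forall x, f (x + 3) = 3 * f (x + 2) - 3 * f (x + 1) + f x) ->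
  \sum_(i < N) f i%:R = N%:R * f 0 + N%:R * (N%:R - 1) / 2 * (f 1 - f 0)
    + N%:R * (N%:R - 1) * (N%:R - 2) / 6 * (f 2 - 2 * f 1 + f 0).
Proof.
elim: N f => [|N IH] f f3; first by rewrite big_ord0; ring.
rewrite big_ord_recl /=.
have -> : \sum_(i < N) f (lift ord0 i)%:R = \sum_(i < N) f (i%:R + 1).
  by apply: eq_bigr => i _; rewrite natr1.
rewrite (IH (fun x => f (x + 1))); last first.
  by move=> x; rewrite [x + 3 + 1]addrAC [x + 2 + 1]addrAC f3.
rewrite add0r -[N.+1%:R]natr1.
have -> : 1 + 1 = 2 :> R by ring.
have -> : f (2 + 1) = 3 * f 2 - 3 * f 1 + f 0.
  by have := f3 0; rewrite !add0r => <-; congr f; ring.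
by move: (N%:R) (f 0) (f 1) (f 2) => x a b c; field.
Qed.

End ClosedSums.

(** * Closed forms of the limiting moments *)

Section LimitMoments.
Variables (R : realFieldType) (k t : nat).
Local Notation K := (k%:R : R).
Local Notation T := (t%:R : R).
Local Notation q := (K / (K + 1)).

Let K1 : K + 1 != 0. Proof. by rewrite natr1 pnatr_eq0. Qed.
Let T1 : T + 1 != 0. Proof. by rewrite natr1 pnatr_eq0. Qed.

(* Limits of the [p]-th moments of the first and of the second run. *)
Definition moment0 p : R :=
  \sum_(i < t.+1) i%:R ^+ p * ((T + K + 1 - i%:R) / ((T + 1) * (K + 1)) * q ^+ i).

Definition moment1 p : R :=
  \sum_(i < t.+1) \sum_(j < (t - i + k).+1)
    j%:R ^+ p * ((T + 2 * K + 1 - i%:R - j%:R) / ((T + 1) * (K + 1) ^+ 2) * q ^+ (i + j)).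

Lemma moment0E p : moment0 p =
  (\sum_(i < t.+1) i%:R ^+ p * (T + K + 1 - i%:R) * q ^+ i) / ((T + 1) * (K + 1)).
Proof. by rewrite mulr_suml; apply: eq_bigr => i _; field; rewrite T1 K1. Qed.

(** For [p <= 2] the tilted summand has degree at most three, within reach of [sum_cubic_geom]. *)
Lemma moment0_closed p (f := fun x => x ^+ p * (T + K + 1 - x)) : (p <= 2)%N ->
  moment0 p =
  (geom_antidiff K f 0 - geom_antidiff K f t.+1%:R * q ^+ t.+1) / ((T + 1) * (K + 1)).
Proof.
move=> p2; rewrite moment0E (sum_cubic_geom (f := f)) //.
by rewrite /f; case: p p2 {f} => [|[|[|]]] // _ x; ring.
Qed.

Lemma variance0 (a := q ^+ t - 1) : moment0 2%N - moment0 1%N ^+ 2 =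
  (- a ^+ 2 * K ^+ 4 + 2 * (T + 2) * a * K ^+ 3
   + ((2 * T + 3) * (T + 1) * a + 3 * T ^+ 2 + 4 * T) * K ^+ 2
   + T * (T + 1) * K) / (T + 1) ^+ 2.
Proof.
rewrite !moment0_closed // /geom_antidiff [q ^+ t.+1]exprS /a -[t.+1%:R]natr1.
move: K1 T1; move: (q ^+ t) K T => u x y x1 y1; field.
by rewrite x1 y1.
Qed.

(** At the upper end of the inner range the exponent [i + j] becomes [(t + k).+1] for every [i], so
    that boundary term carries no geometric factor into the outer sum. *)
Lemma moment1_inner p i (f := fun x => x ^+ p * (T + 2 * K + 1 - i%:R - x)) :
  (p <= 2)%N -> (i <= t)%N ->
  \sum_(j < (t - i + k).+1)
    j%:R ^+ p *
      ((T + 2 * K + 1 - i%:R - j%:R) / ((T + 1) * (K + 1) ^+ 2) * q ^+ (i + j)) =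
  (geom_antidiff K f 0 * q ^+ i - geom_antidiff K f (T + K + 1 - i%:R) * q ^+ (t + k).+1)
  / ((T + 1) * (K + 1) ^+ 2).
Proof.
move=> p2 le_it.
have -> : T + K + 1 - i%:R = (t - i + k).+1%:R by rewrite -natr1 natrD natrB //; ring.
have -> : ((t + k).+1 = (t - i + k).+1 + i)%N by lia.
rewrite exprD mulrA -mulrBl -(sum_cubic_geom (f := f)) //.
  rewrite !mulr_suml; apply: eq_bigr => j _; rewrite exprD /f.
  by move: (q ^+ i) (q ^+ j) K1 T1 => u v x1 y1; field; rewrite x1 y1.
by rewrite /f; case: p p2 {f} => [|[|[|]]] // _ x; ring.
Qed.

Lemma moment1_closed p
  (f := fun y x => x ^+ p * (T + 2 * K + 1 - y - x))
  (g := fun y => geom_antidiff K (f y) 0)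
  (h := fun y => geom_antidiff K (f y) (T + K + 1 - y)) : (p <= 2)%N ->
  moment1 p = (geom_antidiff K g 0 - geom_antidiff K g (T + 1) * q ^+ t.+1
   - ((T + 1) * h 0 + (T + 1) * T / 2 * (h 1 - h 0)
      + (T + 1) * T * (T - 1) / 6 * (h 2 - 2 * h 1 + h 0)) * q ^+ (t + k).+1)
  / ((T + 1) * (K + 1) ^+ 2).
Proof.
move=> p2; have -> : moment1 p =
    (\sum_(i < t.+1) g i%:R * q ^+ i - (\sum_(i < t.+1) h i%:R) * q ^+ (t + k).+1)
    / ((T + 1) * (K + 1) ^+ 2).
  rewrite mulr_suml -sumrB mulr_suml; apply: eq_bigr => i _.
  by rewrite moment1_inner // -ltnS.
rewrite (sum_cubic_geom (f := g)) //; last first.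
  by rewrite /g /geom_antidiff /f; case: p p2 {f g h} => [|[|[|]]] // _ x; ring.
(* At [x = T + K + 1 - y + c] the linear factor is [K - c], free of [y]; hence [h] has degree at
   most [p <= 2]. *)
rewrite (sum_quadratic (f := h)); last first.
  by rewrite /h /geom_antidiff /f; case: p p2 {f g h} => [|[|[|]]] // _ x; ring.
rewrite -[t.+1%:R]natr1; congr ((_ - _ * _) / _).
by move: (h 0) (h 1) (h 2) T => a b c y; field.
Qed.

Lemma moment11 : moment1 1%N =
  ((T + 1) * K ^+ (k + t + 2) + K ^+ (t + 2) * (K + 1) ^+ (k + 1)
    - K * (K - T) * (K + 1) ^+ (k + t + 1)) / ((K + 1) ^+ (k + t + 1) * (T + 1)).
Proof.
rewrite moment1_closed // /geom_antidiff !exprS !exprD !expr_div_n.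
have Kt : (K + 1) ^+ t != 0 by rewrite expf_neq0.
have Kk : (K + 1) ^+ k != 0 by rewrite expf_neq0.
move: Kt Kk K1 T1; move: ((K + 1) ^+ t) ((K + 1) ^+ k) (K ^+ t) (K ^+ k) K T.
move=> a b c d x y a0 b0 x1 y1; field.
by rewrite a0 b0 x1 y1.
Qed.

Lemma moment12 : moment1 2%N =
  ((6 * K + T + 3) * (T + 1) * K ^+ (k + t + 2)
    + (4 * K + 1) * (K + 1) ^+ (k + 1) * K ^+ (t + 2)
    - (4 * K ^+ 2 - 2 * K * T + 3 * K - T) * K * (K + 1) ^+ (k + t + 1))
  / ((K + 1) ^+ (k + t + 1) * (T + 1)).
Proof.
rewrite moment1_closed // /geom_antidiff !exprS !exprD !expr_div_n.
have Kt : (K + 1) ^+ t != 0 by rewrite expf_neq0.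
have Kk : (K + 1) ^+ k != 0 by rewrite expf_neq0.
move: Kt Kk K1 T1; move: ((K + 1) ^+ t) ((K + 1) ^+ k) (K ^+ t) (K ^+ k) K T.
move=> a b c d x y a0 b0 x1 y1; field.
by rewrite a0 b0 x1 y1.
Qed.

End LimitMoments.

(** * Variance through two moments, and Landau notation *)

Lemma unif_varE (R : realType) (T : finType) (A : {set T}) (X : T -> R) :
  unif_var A X = unif_mean A (fun x => X x ^+ 2) - unif_mean A X ^+ 2.
Proof.
rewrite /unif_var; set m := unif_mean A X.
(* For empty [A], division by zero makes both sides [0]. *)
have [A0|A0] := eqVneq (#|A|%:R : R) 0.
  by rewrite /m /unif_mean A0 invr0 !mulr0 expr0n subrr.
have sumX : \sum_(x in A) X x = m * #|A|%:R by rewrite mulfVK.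
rewrite /unif_mean.
have -> : \sum_(x in A) (X x - m) ^+ 2 =
    \sum_(x in A) X x ^+ 2 - 2 * m * (\sum_(x in A) X x) + m ^+ 2 * #|A|%:R.
  rewrite mulr_sumr -sumrB mulr_natr -sumr_const -big_split /=.
  by apply: eq_bigr => x _; ring.
by rewrite sumX; field.
Qed.

Lemma rate_to_bigO (R : realType) (f : nat -> R) (c : R) :
  rate_to f c -> f = (fun=> c) +O_\oo (fun n : nat => n%:R^-1 : R).
Proof.
move=> [C [N fC]]; apply/eqaddOP.
exists C; split; first exact: num_real.
move=> D CD; exists N.+1 => // n /= lt_n.
rewrite [`|n%:R^-1|]ger0_norm ?invr_ge0 ?ler0n //.
by rewrite (le_trans (fC n lt_n)) // ler_wpM2r ?invr_ge0 ?ler0n // ltW.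
Qed.

(** * Asymptotics of the three variances *)

Section Variances.
Variables (R : realType) (k t : nat).
Hypotheses (hk : (1 <= k)%N) (ht : (t <= k)%N).
Local Notation K := (k%:R : R).
Local Notation T := (t%:R : R).
Local Notation F n a := ((raney k n a)%:R : R).

Lemma card_kt_dyck_paths n : #|kt_dyck_paths k t n| = raney k n t.+1.
Proof.
apply/eqP; rewrite -(eqr_nat R) -sum1_card natr_sum.
rewrite (@sum_kt_dyck R k t n (fun=> 1)) ups_sum_cst //.
  by rewrite mul1r.
by rewrite leqnn orbT.
Qed.

Lemma mean_kt_dyck n (X : seq bool -> R) :
  unif_mean (kt_dyck_paths k t n) (fun s : (k.+1 * n).-tuple bool => X s) =
  ups_sum k t n t X / F n t.+1.
Proof. by rewrite /unif_mean card_kt_dyck_paths (@sum_kt_dyck R k t n X). Qed.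

Lemma varXE n r (E := fun p =>
    ups_sum k t n t (fun s => (down_steps r s)%:R ^+ p) / F n t.+1) :
  varX R k n t r = E 2%N - E 1%N ^+ 2.
Proof.
rewrite /varX unif_varE (mean_kt_dyck n (fun s => (down_steps r s)%:R)).
by rewrite (mean_kt_dyck n (fun s => (down_steps r s)%:R ^+ 2)).
Qed.

Lemma rate_to_var (f : nat -> nat -> R) (c : nat -> R) :
  (forall p, rate_to (f p) (c p)) ->
  rate_to (fun n => f 2%N n - f 1%N n ^+ 2) (c 2%N - c 1%N ^+ 2).
Proof.
move=> fc; have := rate_toD (fc 2%N)
  (rate_toM (rate_to_cst (-1)) (rate_toM (fc 1%N) (fc 1%N))).
by rewrite mulN1r -expr2; apply: rate_to_eq => n _; rewrite mulN1r -expr2.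
Qed.

Lemma rate_to_varX0 :
  rate_to (fun n => varX R k n t 0) (moment0 R k t 2%N - moment0 R k t 1%N ^+ 2).
Proof.
have := rate_to_var (f := fun p n =>
  ups_sum k t n t (fun s => (down_steps 0 s)%:R ^+ p) / F n t.+1) (c := moment0 R k t).
move=> H; apply: rate_to_eq (H _) => [n _|p]; first by rewrite varXE.
apply: (@rate_to_eq _ (fun n => \sum_(i < t.+1) i%:R ^+ p *
  (F n.-1 (t - i + k).+1 / F n t.+1))).
  case=> // n _; rewrite (ups_sum_first ht _ (fun d => d%:R ^+ p)) mulr_suml.
  by apply: eq_bigr => i _; rewrite mulrA.
apply: rate_to_sum => i; apply: rate_toM; first exact: rate_to_cst.
have it : (i <= t)%N by rewrite -ltnS.
have := rate_to_raney_pred R hk (t - i + k).+1 t.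
(* One up-step and [i] down-steps have been removed, so [m = 1]. *)
rewrite -[growth R k]expr1 (@weight_shift _ _ hk _ _ _ i); last by lia.
rewrite expr1 -natr1 natrD natrB // -[t.+1%:R]natr1.
by congr (rate_to _ (_ / _ * _)); ring.
Qed.

Lemma rate_to_varX1 :
  rate_to (fun n => varX R k n t 1) (moment1 R k t 2%N - moment1 R k t 1%N ^+ 2).
Proof.
have := rate_to_var (f := fun p n =>
  ups_sum k t n t (fun s => (down_steps 1 s)%:R ^+ p) / F n t.+1) (c := moment1 R k t).
move=> H; apply: rate_to_eq (H _) => [n _|p]; first by rewrite varXE.
apply: (@rate_to_eq _ (fun n => \sum_(i < t.+1) \sum_(j < (t - i + k).+1) j%:R ^+ p *
  (F n.-2 (t - i + k - j + k).+1 / F n t.+1))).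
  case=> [//|[//|n]] _; rewrite (ups_sum_second ht _ (fun d => d%:R ^+ p)) mulr_suml.
  apply: eq_bigr => i _; rewrite mulr_suml.
  by apply: eq_bigr => j _; rewrite mulrA.
apply: rate_to_sum => i; apply: rate_to_sum => j.
apply: rate_toM; first exact: rate_to_cst.
have it : (i <= t)%N by rewrite -ltnS.
have jt : (j <= t - i + k)%N by rewrite -ltnS.
have := rate_to_raney_pred2 R hk (t - i + k - j + k).+1 t.
(* Two runs are gone: [m = 2], with [i + j] down-steps in all. *)
rewrite (@weight_shift _ _ hk _ _ _ (i + j)); last by lia.
rewrite -natr1 natrD natrB // natrD natrB // -[t.+1%:R]natr1.
by congr (rate_to _ (_ / _ * _)); ring.
Qed.

(** Translation does not change the variance, so it may be computed for [L]: with [r1] and [r2] the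
    one-step and two-step ratios of path counts, it is [2 * r2 - (2 * k + 1) * r1 - r1^2]. Since
    [r1] and [r2] tend to [growth] and its square, the limit is
    [growth^2 - (2 * k + 1) * growth]. *)
Lemma rate_to_varX_last :
  rate_to (fun n => varX R k n t n)
    (((K + 1) ^+ (2 * k + 2) - (2 * K + 1) * (K + 1) ^+ (k + 1) * K ^+ k) / K ^+ (2 * k)).
Proof.
have r1 := rate_to_raney_succ R hk t.+1 t.
have r2 := rate_to_raney_succ2 R hk t.+1 t.
have := rate_toD (rate_toM (rate_to_cst 2) r2) (rate_toM (rate_to_cst (-1))
  (rate_toD (rate_toM (rate_to_cst (2 * K + 1)) r1) (rate_toM r1 r1))).
have -> : 2 * (weight R k t.+1 / weight R k t.+1 * growth R k ^+ 2) +
    - 1 * ((2 * K + 1) * (weight R k t.+1 / weight R k t.+1 * growth R k) +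
    weight R k t.+1 / weight R k t.+1 * growth R k *
    (weight R k t.+1 / weight R k t.+1 * growth R k)) =
    ((K + 1) ^+ (2 * k + 2) - (2 * K + 1) * (K + 1) ^+ (k + 1) * K ^+ k) / K ^+ (2 * k).
  rewrite weight_self // growthE // expr_div_n !mul2n -!addnn !exprD.
  have : K ^+ k != 0 by rewrite expf_neq0 // pnatr_eq0 -lt0n.
  by move: (K ^+ k) ((K + 1) ^+ k) K => x y z x0; field.
apply: rate_to_eq => -[//|n] _; rewrite varXE -!sum_kt_dyck.
have := ups_sum_last1 R ht n; have := ups_sum_last2 R ht n; rewrite -!sum_kt_dyck.
pose d s := (down_steps n.+1 s)%:R : R.
have -> : \sum_(s in kt_dyck_paths k t n.+1)
      (d s + t.+1%:R) * (d s + t.+1%:R + (2 * k + 1)%:R) =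
    \sum_(s in kt_dyck_paths k t n.+1) d s ^+ 2 +
    (2 * T + 2 * K + 3) * (\sum_(s in kt_dyck_paths k t n.+1) d s ^+ 1) +
    (T + 1) * (T + 2 * K + 2) * F n.+1 t.+1.
  rewrite -card_kt_dyck_paths -sumr_const !mulr_sumr -!big_split /=.
  apply: eq_bigr => s _; rewrite natrD natrM -[t.+1%:R]natr1.
  by move: (d s) K T => x y z; ring.
have -> : \sum_(s in kt_dyck_paths k t n.+1) (d s + t.+1%:R) =
    \sum_(s in kt_dyck_paths k t n.+1) d s ^+ 1 + (T + 1) * F n.+1 t.+1.
  rewrite -card_kt_dyck_paths -sumr_const mulr_sumr -big_split /=.
  by apply: eq_bigr => s _; rewrite -[t.+1%:R]natr1 mulr1.
rewrite /d; have := raney_neq0 R k n.+1 t.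
move: (F n.+1 _) (F n.+2 _) (F n.+3 _) (\sum_(s in _) _) (\sum_(s in _) _) K T.
move=> a b c x1 x2 y z a0 E2 E1.
(* The insertion identities express the two larger path counts by the moment sums [x1], [x2] and the
   count [a]. *)
have -> : b = x1 + (z + 1) * a by [].
have -> : c = (x2 + (2 * z + 2 * y + 3) * x1 + (z + 1) * (z + 2 * y + 2) * a) / 2.
  by rewrite E2; field.
by field.
Qed.

End Variances.

Theorem theorem6p4 (R : realType) (k t : nat) (hk : (1 <= k)%N) (ht : (t <= k)%N) :
  let K : R := k%:R in
  let T : R := t%:R in
  let a : R := alpha R t k in
  [/\ (fun n : nat => varX R k n t 0) =
        (fun _ : nat =>
           (- a ^+ 2 * K ^+ 4 + 2 * (T + 2) * a * K ^+ 3
            + ((2 * T + 3) * (T + 1) * a + 3 * T ^+ 2 + 4 * T) * K ^+ 2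
            + T * (T + 1) * K) / (T + 1) ^+ 2)
        +O_\oo (fun n : nat => n%:R^-1 : R),
      (fun n : nat => varX R k n t 1) =
        (fun _ : nat =>
           ((6 * K + T + 3) * (T + 1) * K ^+ (k + t + 2)
            + (4 * K + 1) * (K + 1) ^+ (k + 1) * K ^+ (t + 2)
            - (4 * K ^+ 2 - 2 * K * T + 3 * K - T) * K * (K + 1) ^+ (k + t + 1))
             / ((K + 1) ^+ (k + t + 1) * (T + 1))
           - (((T + 1) * K ^+ (k + t + 2) + K ^+ (t + 2) * (K + 1) ^+ (k + 1)
               - K * (K - T) * (K + 1) ^+ (k + t + 1))
                / ((K + 1) ^+ (k + t + 1) * (T + 1))) ^+ 2)
        +O_\oo (fun n : nat => n%:R^-1 : R)
    & (fun n : nat => varX R k n t n) =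
        (fun _ : nat =>
           ((K + 1) ^+ (2 * k + 2)
            - (2 * K + 1) * (K + 1) ^+ (k + 1) * K ^+ k) / K ^+ (2 * k))
        +O_\oo (fun n : nat => n%:R^-1 : R)].
Proof.
move=> K T a; split; apply: rate_to_bigO.
- by rewrite /a /alpha /K /T -(variance0 R k t); apply: rate_to_varX0.
- by have := rate_to_varX1 R hk ht; rewrite moment12 moment11.
- exact: rate_to_varX_last.
Qed.
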